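(* Let $(S,\cdot,\ast)$ be a regular $\star$-semigroup. Define binary operations $+$ and $\oplus$ on $S$ by $a+b=a^{\ast}b$ and $a\oplus b=ab^{\ast}$ for all $a,b\in S$. Then the following hold. (A) The identity $x(y+z)=xy+x(x^{\ast}+z)$ holds for all $x,y,z\in S$ if and only if $(S,\cdot)$ is commutative. Likewise, the identity $(z\oplus y)x=(z\oplus x^{\ast})x\oplus yx$ holds for all $x,y,z\in S$ if and only if $(S,\cdot)$ is commutative. (B) The following are equivalent: (1) $(S,+)$ is a semigroup; (2) $(z+y)x=(z+x^{\ast})x+yx$ for all $x,y,z\in S$; (3) $x=x^{\ast}$ for all $x\in S$. Likewise, the following are equivalent: (1') $(S,\oplus)$ is a semigroup; (2') $x(y\oplus z)=xy\oplus x(x^{\ast}\oplus z)$ for all $x,y,z\in S$; (3) $x=x^{\ast}$ for all $x\in S$. (C) If $x=x^\ast$ for all $x\in S$, then $(S,\cdot)$ is commutative. Thus $(S,+,\cdot,\ast)$ is a left (or equivalently, right; or equivalently, two-sided) regular $\star$-semibrace if and only if $x=x^{\ast}$ for all $x\in S$, and the same holds for $(S,\oplus,\cdot,\ast)$.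
   Context: A regular $\star$-semigroup is a triple $(S,\cdot,\ast)$ where $(S,\cdot)$ is a semigroup on a non-empty set and $\ast:S\to S$, $x\mapsto x^\ast$, satisfies $xx^\ast x=x$, $(x^\ast)^\ast=x$, $(xy)^\ast=y^\ast x^\ast$ for all $x,y\in S$. Let $(S,+,\cdot,\ast)$ be such that $(S,+)$ is a semigroup and $(S,\cdot,\ast)$ is a regular $\star$-semigroup. It is a left regular $\star$-semibrace if $x(y+z)=xy+x(x^{\ast}+z)$ for all $x,y,z\in S$; a right regular $\star$-semibrace if $(z+y)x=(z+x^{\ast})x+yx$ for all $x,y,z\in S$; two-sided if both hold. Multiplication has precedence over addition. The same terminology is used with $\oplus$ in place of $+$. *)

(* Defs.v *)
From mathcomp Require Import all_boot.

Set Implicit Arguments.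
Unset Strict Implicit.
Unset Printing Implicit Defensive.

Definition is_semigroup (S : Type) (op : S -> S -> S) : Prop := associative op.

Record is_regular_star_semigroup (S : Type) (mul : S -> S -> S)
    (star : S -> S) : Prop := RegularStarSemigroup {
  rss_nonempty : inhabited S;
  rss_semigroup : is_semigroup mul;
  rss_regular : forall x, mul (mul x (star x)) x = x;
  rss_involutive : forall x, star (star x) = x;
  rss_antimorphism : forall x y, star (mul x y) = mul (star y) (star x)
}.

Definition left_semibrace_law (S : Type) (add mul : S -> S -> S)
    (star : S -> S) : Prop :=
  forall x y z, mul x (add y z) = add (mul x y) (mul x (add (star x) z)).

Definition right_semibrace_law (S : Type) (add mul : S -> S -> S)
    (star : S -> S) : Prop :=
  forall x y z, mul (add z y) x = add (mul (add z (star x)) x) (mul y x).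

Record is_left_regular_star_semibrace (S : Type) (add mul : S -> S -> S)
    (star : S -> S) : Prop := LeftRegularStarSemibrace {
  left_add_semigroup : is_semigroup add;
  left_mul_regular_star : is_regular_star_semigroup mul star;
  left_law : left_semibrace_law add mul star
}.

Record is_right_regular_star_semibrace (S : Type) (add mul : S -> S -> S)
    (star : S -> S) : Prop := RightRegularStarSemibrace {
  right_add_semigroup : is_semigroup add;
  right_mul_regular_star : is_regular_star_semigroup mul star;
  right_law : right_semibrace_law add mul star
}.

Definition is_two_sided_regular_star_semibrace (S : Type)
    (add mul : S -> S -> S) (star : S -> S) : Prop :=
  is_left_regular_star_semibrace add mul star /\
  is_right_regular_star_semibrace add mul star.

Definition star_add (S : Type) (mul : S -> S -> S) (star : S -> S) : S -> S -> S :=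
  fun a b => mul (star a) b.

Definition star_oplus (S : Type) (mul : S -> S -> S) (star : S -> S) : S -> S -> S :=
  fun a b => mul a (star b).

(* Main.v *)
Require Import Defs.
From mathcomp Require Import all_boot.

Set Implicit Arguments.
Unset Strict Implicit.

(** Writing x' for the star of x, each law for + is a word identity, and
    specializing it suffices.  The left law reads x y' z = y' x' x x z;
    y = x' x makes x' x a left identity on x z, whence x y z = y x z, and the
    star gives z x y = z y x.  Associativity of + and the right law each give
    x = x' x' x = x' x x, whose star is x' = x' x x = x.
    Everything about oplus follows by duality: in the opposite multiplication,
    oplus is + with its arguments swapped, and left and right laws are
    exchanged. *)

Lemma regular_star_semigroup_op (S : Type) (mul : S -> S -> S) (star : S -> S) :
  is_regular_star_semigroup mul star ->
  is_regular_star_semigroup (fun x y => mul y x) star.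
Proof.
by case=> ne mulA reg starK starM; split=> // x; rewrite mulA.
Qed.

(** The antimorphism law reverses products: xy = (xy)' = y'x' = yx. *)
Lemma star_id_commutative (S : Type) (mul : S -> S -> S) (star : S -> S) :
  is_regular_star_semigroup mul star ->
  (forall x, x = star x) -> commutative mul.
Proof. by case=> _ _ _ _ starM e x y; rewrite {1}(e (mul x y)) starM -!e. Qed.

Lemma left_law_addP (S : Type) (mul : S -> S -> S) (star : S -> S) :
  is_regular_star_semigroup mul star ->
  left_semibrace_law (star_add mul star) mul star <-> commutative mul.
Proof.
case=> _ mulA reg starK starM; split=> [law | mulC x y z]; last first.
  (* Expanding x on the left as x x' x and commuting gives y' x' x x z. *)
  rewrite /star_add starM starK !mulA (mulC x) -{1}(reg x).
  by rewrite (mulC x (star x)) !mulA.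
have word x y z :
    mul (mul x y) z = mul (mul (mul (mul y (star x)) x) x) z.
  by have := law x (star y) z; rewrite /star_add starM !starK !mulA.
have unit x z : mul x z = mul (mul (mul (star x) x) x) z.
  have := word x (mul (star x) x) z; rewrite !mulA reg => ->.
  by have := reg (star x); rewrite starK => ->.
have swapl x y z : mul (mul x y) z = mul (mul y x) z.
  by rewrite word -[RHS]mulA (unit x z) !mulA.
have swapr x y z : mul z (mul x y) = mul z (mul y x).
  by rewrite -[LHS]starK -[RHS]starK; congr star; rewrite !starM swapl.
(* The swaps need a third factor beside them, and regularity supplies it: xy = (xx')(xy) = (xx')(yx)
   = y(xx')x = yx. *)
move=> x y; rewrite -{1}(reg x) -mulA swapr mulA swapl -mulA.
by rewrite reg.
Qed.

Lemma add_semigroupP (S : Type) (mul : S -> S -> S) (star : S -> S) :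
  is_regular_star_semigroup mul star ->
  is_semigroup (star_add mul star) <-> (forall x, x = star x).
Proof.
move=> hS; have [_ mulA reg starK starM] := hS; split=> [addA x | e x y z].
  have word u y z : mul (mul (star u) y) z = mul (mul y u) z.
    by have := addA u (star y) z; rewrite /star_add starM !starK !mulA.
  (* Taking u = x in [word] gives x' x x = x x x; taking u = x' gives x x x = x x' x = x. *)
  have h : x = mul (mul (star x) x) x.
    by rewrite word; have := word (star x) x x; rewrite reg starK.
  have h' : star x = mul (mul (star x) (star x)) x.
    by rewrite {1}h !starM starK mulA.
  by rewrite h' word.
by rewrite /star_add -!e mulA.
Qed.

Lemma right_law_addP (S : Type) (mul : S -> S -> S) (star : S -> S) :
  is_regular_star_semigroup mul star ->
  right_semibrace_law (star_add mul star) mul star <-> (forall x, x = star x).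
Proof.
move=> hS; have [_ mulA reg starK starM] := hS; split=> [law x | e x y z].
  have word y z : mul (mul (star z) y) x =
      mul (mul (mul (mul (star x) x) z) y) x.
    by have := law x y z; rewrite /star_add !starM !starK !mulA.
  have reg' : mul (mul (star x) x) (star x) = star x.
    by have := reg (star x); rewrite starK.
  have h1 : x = mul (mul (star x) (star x)) x.
    by have := word (star x) (star x); rewrite starK reg reg'.
  have h2 : star x = mul (mul (star x) x) x.
    by rewrite {1}h1 !starM starK mulA.
  (* Here x = x' x' x = x' x (x x' x) = x' x x = x', the second equality being [word] with z = x and
     y = x'. *)
  by rewrite h2 {1}h1 word -(mulA _ x (star x)) -mulA reg.
(* With a trivial star the law reads zyx = zxxyx. After commuting y and x, it follows from
   regularity in the form x = xxx. *)
have mulC := star_id_commutative hS e.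
rewrite /star_add -!e -mulA -(mulA _ x (mul y x)) (mulC y x).
by rewrite -{1}(reg x) -e !mulA.
Qed.

Lemma right_law_oplusP (S : Type) (mul : S -> S -> S) (star : S -> S) :
  is_regular_star_semigroup mul star ->
  right_semibrace_law (star_oplus mul star) mul star <-> commutative mul.
Proof.
(* The left law for the opposite product is convertible to the present right law, so only the
   commutativity equation has to be turned around. *)
move=> /regular_star_semigroup_op /left_law_addP opP.
by split=> [/opP mulC x y | mulC]; [|apply/opP=> x y]; rewrite mulC.
Qed.

Lemma oplus_semigroupP (S : Type) (mul : S -> S -> S) (star : S -> S) :
  is_regular_star_semigroup mul star ->
  is_semigroup (star_oplus mul star) <-> (forall x, x = star x).
Proof.
move=> /regular_star_semigroup_op /add_semigroupP opP.
(* Passing to the opposite operation exchanges the two sides of associativity. *)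
by split=> [addA | /opP addA x y z]; [apply/opP=> x y z|]; apply/esym/addA.
Qed.

Lemma left_law_oplusP (S : Type) (mul : S -> S -> S) (star : S -> S) :
  is_regular_star_semigroup mul star ->
  left_semibrace_law (star_oplus mul star) mul star <-> (forall x, x = star x).
Proof. by move=> /regular_star_semigroup_op /right_law_addP. Qed.

Theorem proposition3p5 (S : Type) (mul : S -> S -> S) (star : S -> S)
    (hS : is_regular_star_semigroup mul star) :
  (* (A) *)
  ((left_semibrace_law (star_add mul star) mul star <-> commutative mul) /\
   (right_semibrace_law (star_oplus mul star) mul star <-> commutative mul)) /\
  (* (B) *)
  (((is_semigroup (star_add mul star) <->
       right_semibrace_law (star_add mul star) mul star) /\
    (right_semibrace_law (star_add mul star) mul star <->
       (forall x, x = star x))) /\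
   ((is_semigroup (star_oplus mul star) <->
       left_semibrace_law (star_oplus mul star) mul star) /\
    (left_semibrace_law (star_oplus mul star) mul star <->
       (forall x, x = star x)))) /\
  (* (C) *)
  (((forall x, x = star x) -> commutative mul) /\
   ((is_left_regular_star_semibrace (star_add mul star) mul star <->
       (forall x, x = star x)) /\
    (is_right_regular_star_semibrace (star_add mul star) mul star <->
       (forall x, x = star x)) /\
    (is_two_sided_regular_star_semibrace (star_add mul star) mul star <->
       (forall x, x = star x))) /\
   ((is_left_regular_star_semibrace (star_oplus mul star) mul star <->
       (forall x, x = star x)) /\
    (is_right_regular_star_semibrace (star_oplus mul star) mul star <->
       (forall x, x = star x)) /\
    (is_two_sided_regular_star_semibrace (star_oplus mul star) mul star <->
       (forall x, x = star x)))).
Proof.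
have starC := star_id_commutative hS.
have [addP oplusP] := (add_semigroupP hS, oplus_semigroupP hS).
have [laddP raddP] := (left_law_addP hS, right_law_addP hS).
have [loplusP roplusP] := (left_law_oplusP hS, right_law_oplusP hS).
(* In all four cases, associativity of the addition yields the trivial star. Conversely, a trivial
   star gives associativity and the law, by way of commutativity for [laddP] and [roplusP]. *)
have addL : is_left_regular_star_semibrace (star_add mul star) mul star <->
    (forall x, x = star x).
  by split=> [[/addP] | e] //; split=> //; [apply/addP | apply/laddP/starC].
have addR : is_right_regular_star_semibrace (star_add mul star) mul star <->
    (forall x, x = star x).
  by split=> [[/addP] | e] //; split=> //; [apply/addP | apply/raddP].
have oplusL : is_left_regular_star_semibrace (star_oplus mul star) mul star <->
    (forall x, x = star x).
  by split=> [[/oplusP] | e] //; split=> //; [apply/oplusP | apply/loplusP].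
have oplusR : is_right_regular_star_semibrace (star_oplus mul star) mul star <->
    (forall x, x = star x).
  by split=> [[/oplusP] | e] //; split=> //;
    [apply/oplusP | apply/roplusP/starC].
rewrite /is_two_sided_regular_star_semibrace; tauto.
Qed.
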